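(* Let $z=(z_1,\dots,z_n)$ where $z_1,\dots,z_n$ are i.i.d. draws from a continuous distribution on $\mathbb{R}$ with a density. Let $J$ be a positive integer with $J\le\sqrt{n}$. Let the parameter space be $\{(\tau,\mu)\in\mathbb{R}^J\times\mathbb{R}^J:\tau_j>0\ \forall j,\ \sum_{j=1}^J\tau_j=1,\ \mu_1<\mu_2<\dots<\mu_J\}$, and let $Q(\tau,\mu,z)=-\sum_{i=1}^n\log f(z_i;\tau,\mu)$ with $f(x;\tau,\mu)=\sum_{j=1}^J\tau_j\phi(x-\mu_j)$, where $\phi$ is the standard normal density. Then the argmin of $Q(\tau,\mu,z)$ over this parameter space is unique almost surely (it contains at most one point for almost every $z$).
   Context: The model need not be correctly specified; $\phi$ denotes the standard normal density. *)

(* Defs.v *)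
From Stdlib Require Import Reals Lra.
Open Scope R_scope.

Fixpoint fsum (N : nat) (g : nat -> R) : R :=
  match N with
  | O => 0
  | S m => fsum m g + g m
  end.

Fixpoint fprod (N : nat) (g : nat -> R) : R :=
  match N with
  | O => 1
  | S m => fprod m g * g m
  end.

Definition phi (x : R) : R := exp (- (x * x) / 2) / sqrt (2 * PI).

Definition mixdens (J : nat) (tau mu : nat -> R) (x : R) : R :=
  fsum J (fun j => tau j * phi (x - mu j)).

Definition Qobj (n J : nat) (tau mu z : nat -> R) : R :=
  - fsum n (fun i => ln (mixdens J tau mu (z i))).

Definition param_space (J : nat) (tau mu : nat -> R) : Prop :=
  (forall j, (j < J)%nat -> 0 < tau j) /\
  fsum J tau = 1 /\
  (forall j, (S j < J)%nat -> mu j < mu (S j)).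

Definition is_argmin (n J : nat) (z tau mu : nat -> R) : Prop :=
  param_space J tau mu /\
  forall tau' mu', param_space J tau' mu' -> Qobj n J tau mu z <= Qobj n J tau' mu' z.

Definition same_param (J : nat) (tau mu tau' mu' : nat -> R) : Prop :=
  forall j, (j < J)%nat -> tau j = tau' j /\ mu j = mu' j.

Definition lebesgue_null (n : nat) (S : (nat -> R) -> Prop) : Prop :=
  forall eps, 0 < eps ->
  exists a b : nat -> nat -> R,
    (forall k i, a k i <= b k i) /\
    (forall z, S z -> exists k, forall i, (i < n)%nat -> a k i <= z i <= b k i) /\
    (forall N, fsum N (fun k => fprod n (fun i => b k i - a k i)) <= eps).

(* Main.v *)
(* Up to terms not depending on the parameters, minus the objective is
   [sum_i ln (sum_j tau_j exp (mu_j z_i - mu_j^2/2))], which is convex in [z] for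
   fixed parameters. Suppose two argmins at [z] have different [z_i]-slopes, separated
   by rationals [p < q]. Since the value function lies above the tangents of every
   argmin, the set of such [z] in a bounded box is a Lipschitz graph over the other
   coordinates, hence null. So almost surely the coordinates of [z] are distinct and
   any two argmins have the same slopes [f'/f] at the [n >= J^2] points [z_i]. Then
   the Wronskian of the two mixtures, an exponential sum with [J^2] terms, vanishes
   identically by Rolle's theorem, so the mixtures are proportional and their
   parameters agree. *)
Require Import Defs.
From Stdlib Require Import Reals Lra Lia Arith ZArith List Sorted Permutation Cantor.
From Stdlib Require Import Classical ClassicalEpsilon.
Import ListNotations.
Open Scope R_scope.

(** * Finite sums *)

Lemma fsum_ext N f g : (forall k, (k < N)%nat -> f k = g k) -> fsum N f = fsum N g.
Proof.
  induction N as [|N IH]; simpl; intros H; [reflexivity|].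
  rewrite IH, H; [reflexivity | lia | intros; apply H; lia].
Qed.

Lemma fsum_le N f g : (forall k, (k < N)%nat -> f k <= g k) -> fsum N f <= fsum N g.
Proof.
  induction N as [|N IH]; simpl; intros H; [lra|].
  apply Rplus_le_compat; [apply IH; intros; apply H; lia | apply H; lia].
Qed.

Lemma fsum_const N x : fsum N (fun _ => x) = INR N * x.
Proof.
  induction N as [|N IH]; [simpl; ring|].
  rewrite S_INR; simpl fsum; rewrite IH; ring.
Qed.

Lemma fsum_0 N f : (forall k, (k < N)%nat -> f k = 0) -> fsum N f = 0.
Proof. intros H; rewrite (fsum_ext N f (fun _ => 0)), fsum_const by exact H; ring. Qed.

Lemma fsum_nonneg N f : (forall k, (k < N)%nat -> 0 <= f k) -> 0 <= fsum N f.
Proof.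
  intros H; rewrite <- (fsum_0 N (fun _ => 0)) by reflexivity; now apply fsum_le.
Qed.

Lemma fsum_plus N f g : fsum N (fun k => f k + g k) = fsum N f + fsum N g.
Proof. induction N as [|N IH]; simpl; [|rewrite IH]; ring. Qed.

Lemma fsum_scal N x f : fsum N (fun k => x * f k) = x * fsum N f.
Proof. induction N as [|N IH]; simpl; [|rewrite IH]; ring. Qed.

Lemma fsum_minus N f g : fsum N (fun k => f k - g k) = fsum N f - fsum N g.
Proof. induction N as [|N IH]; simpl; [|rewrite IH]; ring. Qed.

Lemma fsum_ge_term N f i :
  (i < N)%nat -> (forall k, (k < N)%nat -> 0 <= f k) -> f i <= fsum N f.
Proof.
  induction N as [|N IH]; intros Hi H; [lia|]; simpl.
  destruct (Nat.eq_dec i N) as [->|Hne].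
  - assert (0 <= fsum N f) by (apply fsum_nonneg; intros; apply H; lia); lra.
  - assert (f i <= fsum N f) by (apply IH; [lia | intros; apply H; lia]).
    assert (0 <= f N) by (apply H; lia); lra.
Qed.

Lemma fsum_pos N f :
  (1 <= N)%nat -> (forall k, (k < N)%nat -> 0 < f k) -> 0 < fsum N f.
Proof.
  intros HN H; apply Rlt_le_trans with (f 0%nat); [apply H; lia|].
  apply fsum_ge_term; [lia | intros; left; now apply H].
Qed.

Lemma fsum_single N i f :
  (i < N)%nat -> fsum N (fun k => if Nat.eqb k i then f k else 0) = f i.
Proof.
  induction N as [|N IH]; intros Hi; [lia|]; simpl.
  destruct (Nat.eqb_spec N i) as [<-|Hne].
  - rewrite fsum_0; [ring|]; intros k Hk.
    destruct (Nat.eqb_spec k N); [lia | reflexivity].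
  - rewrite IH by lia; ring.
Qed.

Lemma fsum_add M N f : fsum (M + N) f = fsum M f + fsum N (fun k => f (M + k)%nat).
Proof.
  induction N as [|N IH]; [rewrite Nat.add_0_r; simpl; ring|].
  rewrite Nat.add_succ_r; simpl; rewrite IH; ring.
Qed.

(** Row-major numbering [q = j * J + k]. It turns the product of two exponential sums into a single
    one indexed by [q]. *)
Lemma fsum_pair J M (g : nat -> nat -> R) :
  fsum (M * J) (fun q => g (q / J)%nat (q mod J)%nat) = fsum M (fun j => fsum J (g j)).
Proof.
  induction M as [|M IH]; [reflexivity|].
  replace (S M * J)%nat with (M * J + J)%nat by lia.
  rewrite fsum_add, IH; simpl; f_equal.
  apply fsum_ext; intros k Hk; f_equal.
  - rewrite Nat.div_add_l, Nat.div_small by lia; lia.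
  - rewrite Nat.add_comm, Nat.Div0.mod_add; now apply Nat.mod_small.
Qed.

(** * Null sets *)

Lemma null_mono n (S T : (nat -> R) -> Prop) :
  (forall z, S z -> T z) -> lebesgue_null n T -> lebesgue_null n S.
Proof.
  intros H HT eps Heps; destruct (HT eps Heps) as (a & b & Hab & Hc & Hs).
  exists a, b; repeat split; auto.
Qed.

Lemma fprod_nonneg N f : (forall k, 0 <= f k) -> 0 <= fprod N f.
Proof.
  intros H; induction N as [|N IH]; simpl; [lra | now apply Rmult_le_pos].
Qed.

(** Passing from [N] to [S N] adds exactly the cell coded by [N], and this cell lies in the [M] by
    [M] square because a Cantor code dominates both of its components. *)
Lemma fsum_of_nat (F : nat -> nat -> R) M N :
  (N <= M)%nat ->
  fsum N (fun t => F (fst (of_nat t)) (snd (of_nat t))) =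
  fsum M (fun k => fsum M (fun l => if Nat.ltb (to_nat (k, l)) N then F k l else 0)).
Proof.
  induction N as [|N IH]; intros HN.
  - simpl; symmetry; apply fsum_0; intros; apply fsum_0; reflexivity.
  - cbn [fsum]; rewrite IH by lia.
    destruct (of_nat N) as [k0 l0] eqn:E; cbn [fst snd].
    assert (EN : to_nat (k0, l0) = N) by (rewrite <- E; apply cancel_to_of).
    assert (Hb := to_nat_non_decreasing k0 l0); rewrite EN in Hb.
    rewrite <- (fsum_single M k0 (fun k => F k l0)) by lia.
    rewrite <- fsum_plus; apply fsum_ext; intros k _; cbv beta.
    replace (if Nat.eqb k k0 then F k l0 else 0) with
      (fsum M (fun l => if Nat.eqb l l0 then (if Nat.eqb k k0 then F k l else 0) else 0))
      by (rewrite (fsum_single M l0 (fun l => if Nat.eqb k k0 then F k l else 0)) by lia;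
          reflexivity).
    rewrite <- fsum_plus; apply fsum_ext; intros l _.
    assert (Hinj : to_nat (k, l) = N <-> k = k0 /\ l = l0).
    { split; [|now intros [-> ->]].
      intros H; rewrite <- EN in H; apply to_nat_inj in H; now injection H. }
    destruct (Nat.ltb_spec (to_nat (k, l)) N), (Nat.ltb_spec (to_nat (k, l)) (S N)),
      (Nat.eqb_spec l l0), (Nat.eqb_spec k k0); try lia; ring.
Qed.

(** The [k]-th set gets a cover of volume at most [eps / 2^(k+1)]; the double sequence of boxes is
    enumerated by Cantor pairing. *)
Lemma null_union n (S : nat -> (nat -> R) -> Prop) :
  (forall k, lebesgue_null n (S k)) -> lebesgue_null n (fun z => exists k, S k z).
Proof.
  intros HS eps Heps.
  assert (Hpos : forall k, 0 < eps * (/ 2) ^ (k + 1)).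
  { intros k; apply Rmult_lt_0_compat; [lra | apply pow_lt; lra]. }
  assert (Hch : forall k, exists ab : (nat -> nat -> R) * (nat -> nat -> R),
    (forall l i, fst ab l i <= snd ab l i) /\
    (forall z, S k z -> exists l, forall i, (i < n)%nat -> fst ab l i <= z i <= snd ab l i) /\
    (forall N, fsum N (fun l => fprod n (fun i => snd ab l i - fst ab l i))
               <= eps * (/ 2) ^ (k + 1))).
  { intros k; destruct (HS k _ (Hpos k)) as (a & b & H); now exists (a, b). }
  set (AB := fun k => proj1_sig (constructive_indefinite_description _ (Hch k))).
  assert (HAB := fun k => proj2_sig (constructive_indefinite_description _ (Hch k))).
  fold AB in HAB; change (forall k, (forall l i, fst (AB k) l i <= snd (AB k) l i) /\
    (forall z, S k z -> exists l, forall i, (i < n)%nat -> fst (AB k) l i <= z i <= snd (AB k) l i) /\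
    (forall N, fsum N (fun l => fprod n (fun i => snd (AB k) l i - fst (AB k) l i))
               <= eps * (/ 2) ^ (k + 1))) in HAB.
  clearbody AB.
  exists (fun t => fst (AB (fst (of_nat t))) (snd (of_nat t))),
         (fun t => snd (AB (fst (of_nat t))) (snd (of_nat t))).
  split; [|split].
  - intros; apply HAB.
  - intros z [k Hk]; destruct (proj1 (proj2 (HAB k)) z Hk) as [l Hl].
    exists (to_nat (k, l)); rewrite cancel_of_to; exact Hl.
  - intros N.
    set (F := fun k l => fprod n (fun i => snd (AB k) l i - fst (AB k) l i)).
    assert (HF : forall k l, 0 <= F k l).
    { intros k l; apply fprod_nonneg; intros i; assert (H := proj1 (HAB k) l i); lra. }
    change (fsum N (fun t => F (fst (of_nat t)) (snd (of_nat t))) <= eps).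
    (* The first [N] codes sit inside an [N] by [N] square. Dropping the indicator bounds each row
       by the budget of its own cover. *)
    rewrite (fsum_of_nat F N N) by lia.
    apply Rle_trans with (fsum N (fun k => eps * (/ 2) ^ (k + 1))).
    + apply fsum_le; intros k _; apply Rle_trans with (fsum N (F k)); [|apply HAB].
      apply fsum_le; intros l _; destruct (Nat.ltb _ _); [lra | apply HF].
    + assert (E : fsum N (fun k => eps * (/ 2) ^ (k + 1)) = eps * (1 - (/ 2) ^ N)).
      { clear; induction N as [|N IH]; simpl; [ring|].
        rewrite IH, pow_add; simpl; field. }
      rewrite E; assert (0 < (/ 2) ^ N) by (apply pow_lt; lra); nra.
Qed.

Lemma null_or n (S T : (nat -> R) -> Prop) :
  lebesgue_null n S -> lebesgue_null n T -> lebesgue_null n (fun z => S z \/ T z).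
Proof.
  intros HS HT.
  apply null_mono with (fun z => exists k : nat, (if Nat.eqb k 0 then S else T) z).
  - intros z [H|H]; [now exists 0%nat | now exists 1%nat].
  - apply null_union; intros k; now destruct (Nat.eqb k 0).
Qed.

(** The [m] choices are the base-[N] digits of [q]; this numbers the cells of a grid with [N]
    divisions along each of [m] axes. *)
Lemma digits_exist N m (P : nat -> nat -> Prop) :
  (forall j, (j < m)%nat -> exists k, (k < N)%nat /\ P j k) ->
  exists q, (q < N ^ m)%nat /\
    forall j, (j < m)%nat -> P j ((q / N ^ j) mod N)%nat.
Proof.
  induction m as [|m IH]; intros H.
  - exists 0%nat; split; [simpl; lia | intros; lia].
  - destruct IH as (q & Hq & HP); [intros; apply H; lia|].
    destruct (H m) as (k & Hk & HPk); [lia|].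
    exists (q + k * N ^ m)%nat; split; [simpl; nia|].
    intros j Hj; destruct (Nat.eq_dec j m) as [->|Hne].
    + rewrite Nat.div_add, Nat.div_small by lia; simpl; rewrite Nat.mod_small; auto.
    + replace (q + k * N ^ m)%nat with (q + k * N ^ (m - j - 1) * N * N ^ j)%nat.
      * rewrite Nat.div_add by (apply Nat.pow_nonzero; lia).
        rewrite Nat.Div0.mod_add; apply HP; lia.
      * replace m with ((m - j - 1) + 1 + j)%nat at 2 by lia.
        rewrite !Nat.pow_add_r, Nat.pow_1_r; ring.
Qed.

Lemma cell_exists x A d N :
  A <= x <= A + INR N * d -> (1 <= N)%nat ->
  exists k, (k < N)%nat /\ A + INR k * d <= x <= A + INR k * d + d.
Proof.
  induction N as [|N IH]; intros Hx HN; [lia|].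
  rewrite S_INR in Hx.
  destruct (Rle_dec (A + INR N * d) x) as [H|H].
  - exists N; split; [lia | lra].
  - destruct N as [|N]; [simpl in H; lra|].
    destruct IH as (k & Hk & Hx'); [lra | lia |]; exists k; split; [lia | exact Hx'].
Qed.

Lemma fprod_ext N f g : (forall k, (k < N)%nat -> f k = g k) -> fprod N f = fprod N g.
Proof.
  induction N as [|N IH]; simpl; intros H; [reflexivity|].
  rewrite IH, H; [reflexivity | lia | intros; apply H; lia].
Qed.

Lemma fprod_const N x : fprod N (fun _ => x) = x ^ N.
Proof. induction N as [|N IH]; simpl; [|rewrite IH]; ring. Qed.

Lemma fprod_update N i x y :
  (i <= N)%nat -> fprod (S N) (fun j => if Nat.eqb j i then x else y) = x * y ^ N.
Proof.
  induction N as [|N IH]; intros Hi.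
  - replace i with 0%nat by lia; simpl; ring.
  - change (fprod (S N) (fun j => if Nat.eqb j i then x else y) *
      (if Nat.eqb (S N) i then x else y) = x * y ^ S N).
    destruct (Nat.eqb_spec (S N) i) as [<-|Hne].
    + rewrite (fprod_ext _ _ (fun _ => y)), fprod_const; [ring|].
      intros k Hk; destruct (Nat.eqb_spec k (S N)); [lia | reflexivity].
    + rewrite IH by lia; simpl; ring.
Qed.

Lemma fsum_ltb_const_le M K v :
  0 <= v -> fsum M (fun q => if Nat.ltb q K then v else 0) <= INR K * v.
Proof.
  intros Hv.
  assert (H : fsum M (fun q => if Nat.ltb q K then v else 0) = INR (Nat.min M K) * v).
  { induction M as [|M IH]; [simpl; ring|].
    simpl fsum; rewrite IH; destruct (Nat.ltb_spec M K).
    - rewrite !Nat.min_l, S_INR by lia; ring.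
    - rewrite !Nat.min_r by lia; ring. }
  rewrite H; apply Rmult_le_compat_r; [exact Hv | apply le_INR; lia].
Qed.

(* Over each cube of side [d] in the other coordinates, a [C]-Lipschitz graph
   is contained in one interval of length [2 C d]. *)
Lemma null_lipschitz_graph n i (S : (nat -> R) -> Prop) r C :
  (i < n)%nat -> 0 <= r -> 0 <= C ->
  (forall z, S z -> forall j, (j < n)%nat -> - r <= z j <= r) ->
  (forall z z' d, S z -> S z' -> 0 <= d ->
     (forall j, (j < n)%nat -> j <> i -> Rabs (z j - z' j) <= d) ->
     Rabs (z i - z' i) <= C * d) ->
  lebesgue_null n S.
Proof.
  intros Hi Hr HC Hbox Hlip eps Heps.
  destruct n as [|m]; [lia|].
  assert (HV : 0 <= 2 * C * (2 * r) ^ (m + 1)).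
  { apply Rmult_le_pos; [lra | apply pow_le; lra]. }
  (* With mesh [d = 2r/N], the [N^m] boxes have total volume [N^m * 2Cd * d^m = 2C (2r)^(m+1) / N],
     so [N] is taken large enough to bring this below [eps]. *)
  destruct (INR_archimed eps (2 * C * (2 * r) ^ (m + 1)) Heps) as [N0 HN0].
  set (N := Datatypes.S N0).
  assert (HNpos : 0 < INR N) by (apply lt_0_INR; unfold N; lia).
  assert (HN : 2 * C * (2 * r) ^ (m + 1) / INR N <= eps).
  { apply Rmult_le_reg_r with (INR N); [exact HNpos|].
    unfold Rdiv; rewrite Rmult_assoc, Rinv_l, Rmult_1_r by lra.
    unfold N; rewrite S_INR; nra. }
  set (d := 2 * r / INR N).
  assert (Hd : 0 <= d) by (apply Rmult_le_pos; [lra | left; now apply Rinv_0_lt_compat]).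
  assert (HNd : INR N * d = 2 * r) by (unfold d; field; lra).
  (* [idx] renumbers the coordinates other than [i] as [0, ..., m-1], and [lo q] is the lower corner
     of the cell coded by [q]. *)
  set (idx := fun j => if Nat.ltb j i then j else (j - 1)%nat).
  set (lo := fun q j => - r + INR ((q / N ^ idx j) mod N) * d).
  set (P := fun q z => S z /\ forall j, (j < Datatypes.S m)%nat -> j <> i ->
                              lo q j <= z j <= lo q j + d).
  (* [c q] is the height of some point of the graph over cell [q], and an arbitrary value when there
     is no such point. Boxes numbered from [N^m] on are degenerate. *)
  set (c := fun q => epsilon (inhabits (fun _ : nat => 0)) (P q) i).
  exists (fun q j => if Nat.ltb q (N ^ m)
                     then (if Nat.eqb j i then c q - C * d else lo q j) else 0),
         (fun q j => if Nat.ltb q (N ^ m)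
                     then (if Nat.eqb j i then c q + C * d else lo q j + d) else 0).
  assert (0 <= C * d) by (now apply Rmult_le_pos).
  split; [|split].
  - intros q j; destruct (Nat.ltb q (N ^ m)), (Nat.eqb j i); lra.
  - intros z Hz.
    set (back := fun l => if Nat.ltb l i then l else Datatypes.S l).
    destruct (digits_exist N m (fun l k =>
        - r + INR k * d <= z (back l) <= - r + INR k * d + d)) as (q & Hq & HP).
    { intros l Hl; apply cell_exists; [|unfold N; lia].
      rewrite HNd; assert (H1 := Hbox z Hz (back l)).
      assert (back l < Datatypes.S m)%nat by (unfold back; destruct (Nat.ltb l i); lia).
      specialize (H1 H0); lra. }
    assert (HPq : P q z).
    { split; [exact Hz|]; intros j Hj Hji.
      assert (Hl : (idx j < m)%nat) by (unfold idx; destruct (Nat.ltb_spec j i); lia).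
      assert (Hbk : back (idx j) = j).
      { unfold idx, back; destruct (Nat.ltb_spec j i).
        - destruct (Nat.ltb_spec j i); lia.
        - destruct (Nat.ltb_spec (j - 1) i); lia. }
      specialize (HP _ Hl); rewrite Hbk in HP; exact HP. }
    assert (Hc := epsilon_spec (inhabits (fun _ : nat => 0)) (P q) (ex_intro _ z HPq)).
    exists q; intros j Hj; destruct (Nat.ltb_spec q (N ^ m)); [|lia].
    destruct (Nat.eqb_spec j i) as [->|Hne]; [|now apply HPq].
    assert (HL : Rabs (z i - c q) <= C * d).
    { unfold c; apply Hlip; [exact Hz | apply Hc | exact Hd |].
      intros k Hk Hki; destruct Hc as [_ Hc], HPq as [_ HPq].
      specialize (Hc k Hk Hki); specialize (HPq k Hk Hki); apply Rabs_le; lra. }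
    unfold Rabs in HL; destruct (Rcase_abs (z i - c q)); lra.
  - intros M.
    apply Rle_trans with (fsum M (fun q => if Nat.ltb q (N ^ m) then 2 * C * d * d ^ m else 0)).
    + apply fsum_le; intros q _; destruct (Nat.ltb q (N ^ m)).
      * rewrite <- (fprod_update m i) by lia; right; apply fprod_ext.
        intros k _; destruct (Nat.eqb k i); ring.
      * right; simpl; ring.
    + apply Rle_trans with (INR (N ^ m) * (2 * C * d * d ^ m)).
      * apply fsum_ltb_const_le, Rmult_le_pos; [nra | now apply pow_le].
      * replace (INR (N ^ m) * (2 * C * d * d ^ m))
          with (2 * C * (2 * r) ^ (m + 1) / INR N); [exact HN|].
        rewrite pow_INR, pow_add, <- HNd, Rpow_mult_distr; rewrite !pow_1; field; lra.
Qed.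

(** * Exponential sums *)

Definition expsum (N : nat) (c a : nat -> R) (x : R) : R :=
  fsum N (fun k => c k * exp (a k * x)).

Lemma derivable_pt_lim_expsum N c a x :
  derivable_pt_lim (expsum N c a) x (expsum N (fun k => c k * a k) a x).
Proof.
  unfold expsum; induction N as [|N IH]; simpl.
  - apply derivable_pt_lim_const.
  - apply derivable_pt_lim_plus with (f2 := fun x => c N * exp (a N * x)); [exact IH|].
    replace (c N * a N * exp (a N * x)) with (c N * (exp (a N * x) * (a N * 1))) by ring.
    apply derivable_pt_lim_scal with (f := fun x => exp (a N * x)).
    apply (derivable_pt_lim_comp (fun x => a N * x) exp).
    + apply derivable_pt_lim_scal with (f := id), derivable_pt_lim_id.
    + apply derivable_pt_lim_exp.
Qed.

Lemma expsum_shift N c a s x :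
  expsum N c (fun k => a k - s) x = exp (- s * x) * expsum N c a x.
Proof.
  unfold expsum; rewrite <- fsum_scal; apply fsum_ext; intros k _.
  replace ((a k - s) * x) with (- s * x + a k * x) by ring; rewrite exp_plus; ring.
Qed.

Lemma expsum_mult J a mu b nu x :
  expsum J a mu x * expsum J b nu x =
  expsum (J * J) (fun q => a (q / J)%nat * b (q mod J)%nat)
                 (fun q => mu (q / J)%nat + nu (q mod J)%nat) x.
Proof.
  unfold expsum.
  rewrite (fsum_pair J J (fun j k => a j * b k * exp ((mu j + nu k) * x))).
  rewrite Rmult_comm, <- fsum_scal; apply fsum_ext; intros j _.
  rewrite Rmult_comm, <- fsum_scal; apply fsum_ext; intros k _.
  rewrite Rmult_plus_distr_r, exp_plus; ring.
Qed.

Lemma expsum_pos N c a x :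
  (1 <= N)%nat -> (forall k, (k < N)%nat -> 0 < c k) -> 0 < expsum N c a x.
Proof.
  intros HN Hc; apply fsum_pos; [exact HN|].
  intros k Hk; apply Rmult_lt_0_compat; [now apply Hc | apply exp_pos].
Qed.

Lemma const_of_derivative_0 F F' :
  (forall x, derivable_pt_lim F x (F' x)) -> (forall x, F' x = 0) ->
  forall x y, F x = F y.
Proof.
  intros HF H0.
  assert (Hlt : forall x y, x < y -> F x = F y).
  { intros x y Hxy; destruct (MVT_cor2 F F' x y Hxy (fun c _ => HF c)) as (c & Hc & _).
    rewrite H0 in Hc; lra. }
  intros x y; destruct (Rtotal_order x y) as [H|[->|H]]; [auto | reflexivity |].
  symmetry; auto.
Qed.

(** One zero of the derivative lies between consecutive zeros. The clause [Forall (Rlt x) l'] keeps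
    the new list sorted: the zero found between [x] and [y] precedes the later ones, all beyond
    [y]. *)
Lemma rolle_list F F' :
  (forall x, derivable_pt_lim F x (F' x)) ->
  forall l x, StronglySorted Rlt (x :: l) -> Forall (fun y => F y = 0) (x :: l) ->
  exists l', length l' = length l /\ StronglySorted Rlt l' /\
    Forall (Rlt x) l' /\ Forall (fun y => F' y = 0) l'.
Proof.
  intros HF; induction l as [|y l IH]; intros x Hs HZ.
  - exists []; repeat split; constructor.
  - apply StronglySorted_inv in Hs as [Hs Hx]; inversion_clear HZ as [|? ? Hx0 HZ'].
    destruct (IH y Hs HZ') as (l' & Hlen & Hs' & Hy & HZl).
    assert (Hxy : x < y) by (now inversion Hx).
    assert (Hy0 : F y = 0) by (now inversion HZ').
    destruct (MVT_cor2 F F' x y Hxy (fun c _ => HF c)) as (c & Hc & Hcxy).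
    assert (Hc0 : F' c = 0) by (rewrite Hx0, Hy0 in Hc; nra).
    exists (c :: l'); split; [simpl; now rewrite Hlen|].
    split; [|split].
    + constructor; [exact Hs'|]; eapply Forall_impl; [|exact Hy]; simpl; intros; lra.
    + constructor; [lra|]; eapply Forall_impl; [|exact Hy]; simpl; intros; lra.
    + now constructor.
Qed.

(* The exponents [a k] need not be distinct: normalizing the last one to [0]
   and differentiating kills at least one term in any case. *)
Lemma expsum_zeros N : forall c a l,
  StronglySorted Rlt l -> (N <= length l)%nat ->
  Forall (fun y => expsum N c a y = 0) l -> forall x, expsum N c a x = 0.
Proof.
  induction N as [|N IH]; intros c a l Hs Hlen HZ x; [reflexivity|].
  destruct l as [|x0 l]; [simpl in Hlen; lia|].
  set (e := fun k => a k - a N).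
  assert (Hshift : forall y, expsum (S N) c e y = exp (- a N * y) * expsum (S N) c a y)
    by (intros; apply expsum_shift).
  assert (HZe : Forall (fun y => expsum (S N) c e y = 0) (x0 :: l)).
  { eapply Forall_impl; [|exact HZ]; simpl; intros y Hy; rewrite Hshift, Hy; ring. }
  destruct (rolle_list _ _ (derivable_pt_lim_expsum (S N) c e) l x0 Hs HZe)
    as (l' & Hlen' & Hs' & _ & HZ').
  (* The last exponent is now [e N = 0], so the derivative has only [N] terms. *)
  assert (Hdrop : forall y, expsum (S N) (fun k => c k * e k) e y =
                            expsum N (fun k => c k * e k) e y).
  { intros y; unfold expsum; simpl; unfold e at 3; ring. }
  assert (H0 : forall y, expsum N (fun k => c k * e k) e y = 0).
  { apply (IH _ _ l'); [exact Hs' | simpl in Hlen; lia |].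
    eapply Forall_impl; [|exact HZ']; simpl; intros y Hy; now rewrite <- Hdrop. }
  assert (Hconst : expsum (S N) c e x = expsum (S N) c e x0).
  { apply (const_of_derivative_0 _ _ (derivable_pt_lim_expsum (S N) c e)).
    intros y; rewrite Hdrop; apply H0. }
  inversion_clear HZe as [|? ? Hx0 _]; rewrite Hx0, Hshift in Hconst.
  apply Rmult_integral in Hconst as [H|H]; [|exact H].
  assert (Hp := exp_pos (- a N * x)); lra.
Qed.

(** * Sorting of distinct points *)

Lemma sorted_insert x l :
  StronglySorted Rlt l -> ~ In x l ->
  exists l', StronglySorted Rlt l' /\ Permutation (x :: l) l'.
Proof.
  induction l as [|y l IH]; intros Hs Hin.
  - exists [x]; split; [repeat constructor | reflexivity].
  - apply StronglySorted_inv in Hs as Hs'; destruct Hs' as [Hs' Hy].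
    destruct (Rtotal_order x y) as [H|[->|H]].
    + exists (x :: y :: l); split; [|reflexivity].
      constructor; [exact Hs|]; constructor; [exact H|].
      eapply Forall_impl; [|exact Hy]; simpl; intros; lra.
    + simpl in Hin; tauto.
    + destruct IH as (l' & Hl' & HP); [exact Hs' | simpl in Hin; tauto |].
      exists (y :: l'); split.
      * constructor; [exact Hl'|]; apply (Permutation_Forall HP); now constructor.
      * rewrite perm_swap; now constructor.
Qed.

Lemma sorted_exists l :
  NoDup l -> exists l', StronglySorted Rlt l' /\ Permutation l l'.
Proof.
  induction 1 as [|x l Hx _ (l' & Hs & HP)].
  - exists []; split; constructor.
  - destruct (sorted_insert x l' Hs) as (l'' & Hs'' & HP'').
    + intros H; apply Hx; eapply Permutation_in; [symmetry; exact HP | exact H].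
    + exists l''; split; [exact Hs''|]; rewrite HP; exact HP''.
Qed.

(** * Uniqueness of exponential sums with positive coefficients *)

Lemma expsum_le N c a A x :
  (forall k, (k < N)%nat -> 0 <= c k) -> (forall k, (k < N)%nat -> a k <= A) -> 0 <= x ->
  expsum N c a x <= fsum N c * exp (A * x).
Proof.
  intros Hc Ha Hx; unfold expsum; rewrite Rmult_comm, <- fsum_scal.
  apply fsum_le; intros k Hk; rewrite (Rmult_comm (exp _)).
  apply Rmult_le_compat_l; [now apply Hc|].
  specialize (Ha k Hk); assert (H : a k * x <= A * x) by nra.
  destruct H as [H|H]; [left; now apply exp_increasing | rewrite H; lra].
Qed.

(** If [s > t], then at [x = B / a / (s - t)] the inequality [exp u >= 1 + u] gives
    [a * exp ((s - t) * x) >= a + B > B]. *)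
Lemma exp_rate_le a B s t :
  0 < a -> (forall x, 0 <= x -> a * exp (s * x) <= B * exp (t * x)) -> s <= t.
Proof.
  intros Ha H; destruct (Rle_lt_dec s t) as [Hst|Hst]; [exact Hst|exfalso].
  assert (HB : a <= B) by (specialize (H 0 (Rle_refl 0)); rewrite !Rmult_0_r, exp_0 in H; lra).
  set (x := B / a / (s - t)).
  assert (Hx : 0 <= x).
  { unfold x, Rdiv; repeat apply Rmult_le_pos; try lra;
      left; apply Rinv_0_lt_compat; lra. }
  specialize (H x Hx).
  replace (s * x) with ((s - t) * x + t * x) in H by ring; rewrite exp_plus in H.
  assert (H' : a * exp ((s - t) * x) <= B).
  { apply Rmult_le_reg_r with (exp (t * x)); [apply exp_pos | lra]. }
  assert (H1 := exp_ineq1_le ((s - t) * x)).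
  assert (E : a * ((s - t) * x) = B) by (unfold x; field; lra).
  nra.
Qed.

Lemma increasing_lt J (mu : nat -> R) :
  (forall j, (S j < J)%nat -> mu j < mu (S j)) ->
  forall j k, (j < k < J)%nat -> mu j < mu k.
Proof.
  intros H j k; induction k as [|k IH]; intros Hjk; [lia|].
  assert (Hk : mu k < mu (S k)) by (apply H; lia).
  destruct (Nat.eq_dec j k) as [->|Hne]; [exact Hk|].
  apply Rlt_trans with (mu k); [apply IH; lia | exact Hk].
Qed.

(** Growth at infinity: the left sum dominates its term of index [J], while the right one is at most
    a constant times [exp (nu J * x)]. *)
Lemma expsum_top_le J a b mu nu :
  (forall j, (j < S J)%nat -> 0 < a j) -> (forall j, (j < S J)%nat -> 0 < b j) ->
  (forall j, (S j < S J)%nat -> nu j < nu (S j)) ->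
  (forall x, expsum (S J) a mu x = expsum (S J) b nu x) -> mu J <= nu J.
Proof.
  intros Ha Hb Hnu E; apply exp_rate_le with (a J) (fsum (S J) b); [apply Ha; lia|].
  intros x Hx; apply Rle_trans with (expsum (S J) b nu x).
  - rewrite <- E; apply (fsum_ge_term (S J) (fun k => a k * exp (mu k * x))); [lia|].
    intros k Hk; left; apply Rmult_lt_0_compat; [now apply Ha | apply exp_pos].
  - apply expsum_le; [intros; left; now apply Hb | | exact Hx].
    intros k Hk; destruct (Nat.eq_dec k J) as [->|Hne]; [lra|].
    left; apply (increasing_lt (S J)); [exact Hnu | lia].
Qed.

(** Were [a J > b J], cancelling the common top exponential would leave
    [(a J - b J) * exp (nu J * x)] bounded by the lower terms on the right, which grow at a strictly
    smaller rate [A]. *)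
Lemma expsum_top_coef_le J a b mu nu :
  (forall j, (j < S J)%nat -> 0 < a j) -> (forall j, (j < S J)%nat -> 0 < b j) ->
  (forall j, (S j < S J)%nat -> nu j < nu (S j)) ->
  (forall x, expsum (S J) a mu x = expsum (S J) b nu x) -> mu J = nu J -> a J <= b J.
Proof.
  intros Ha Hb Hnu E Etop; destruct (Rle_lt_dec (a J) (b J)) as [H|H]; [exact H|exfalso].
  assert (HA : exists A, A < nu J /\ forall k, (k < J)%nat -> nu k <= A).
  { destruct J as [|J]; [exists (nu 0%nat - 1); split; [lra | intros; lia]|].
    exists (nu J); split; [apply Hnu; lia|].
    intros k Hk; destruct (Nat.eq_dec k J) as [->|Hne]; [lra|].
    left; apply (increasing_lt (S (S J))); [exact Hnu | lia]. }
  destruct HA as (A & HAJ & HA).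
  assert (Hle : nu J <= A); [|lra].
  apply exp_rate_le with (a J - b J) (fsum J b); [lra|].
  intros x Hx; specialize (E x); unfold expsum in E; simpl in E; rewrite Etop in E.
  assert (Hb' : expsum J b nu x <= fsum J b * exp (A * x)).
  { apply expsum_le; [intros; left; apply Hb; lia | exact HA | exact Hx]. }
  assert (Ha' : 0 <= expsum J a mu x).
  { apply fsum_nonneg; intros k Hk; left; apply Rmult_lt_0_compat;
      [apply Ha; lia | apply exp_pos]. }
  unfold expsum in Ha', Hb'; lra.
Qed.

(** Both comparisons, applied in each direction, identify the top terms; these cancel and the
    induction continues with one term fewer. *)
Lemma expsum_unique J a b mu nu :
  (forall j, (j < J)%nat -> 0 < a j) -> (forall j, (j < J)%nat -> 0 < b j) ->
  (forall j, (S j < J)%nat -> mu j < mu (S j)) ->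
  (forall j, (S j < J)%nat -> nu j < nu (S j)) ->
  (forall x, expsum J a mu x = expsum J b nu x) ->
  forall j, (j < J)%nat -> a j = b j /\ mu j = nu j.
Proof.
  induction J as [|J IH]; intros Ha Hb Hmu Hnu E j Hj; [lia|].
  assert (E' : forall x, expsum (S J) b nu x = expsum (S J) a mu x) by (intros; now rewrite E).
  assert (Etop : mu J = nu J).
  { apply Rle_antisym; [apply (expsum_top_le J a b) | apply (expsum_top_le J b a)]; auto. }
  assert (Ecoef : a J = b J).
  { apply Rle_antisym;
      [apply (expsum_top_coef_le J a b mu nu) | apply (expsum_top_coef_le J b a nu mu)]; auto. }
  destruct (Nat.eq_dec j J) as [->|Hne]; [now split|].
  apply IH; try (intros; (apply Ha || apply Hb || apply Hmu || apply Hnu); lia); [|lia].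
  intros x; specialize (E x); unfold expsum in E |- *; simpl in E.
  rewrite Etop, Ecoef in E; lra.
Qed.

(** * Log-likelihood slopes *)

(** The weight of [exp (mu j * x)] once the standard normal density at [x] is factored out of
    [tau j * phi (x - mu j)]. *)
Definition coef (tau mu : nat -> R) (j : nat) : R := tau j * exp (- (mu j * mu j) / 2).

Definition mgf (J : nat) (tau mu : nat -> R) : R -> R := expsum J (coef tau mu) mu.

Definition mgf' (J : nat) (tau mu : nat -> R) : R -> R :=
  expsum J (fun j => coef tau mu j * mu j) mu.

(** The derivative of [ln mgf], equal to [f'/f + x] for the mixture density [f]. *)
Definition slope (J : nat) (tau mu : nat -> R) (x : R) : R :=
  mgf' J tau mu x / mgf J tau mu x.

Lemma coef_pos J tau mu :
  param_space J tau mu -> forall j, (j < J)%nat -> 0 < coef tau mu j.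
Proof.
  intros (H & _) j Hj; apply Rmult_lt_0_compat; [now apply H | apply exp_pos].
Qed.

Lemma mgf_pos J tau mu x : (1 <= J)%nat -> param_space J tau mu -> 0 < mgf J tau mu x.
Proof. intros HJ H; apply expsum_pos; [exact HJ | now apply coef_pos]. Qed.

Lemma mixdens_mgf J tau mu x :
  mixdens J tau mu x = exp (- (x * x) / 2) / sqrt (2 * PI) * mgf J tau mu x.
Proof.
  unfold mixdens, mgf, expsum; rewrite <- fsum_scal; apply fsum_ext; intros j _.
  unfold phi, coef.
  replace (- ((x - mu j) * (x - mu j)) / 2)
    with (- (x * x) / 2 + (- (mu j * mu j) / 2 + mu j * x)) by field.
  rewrite !exp_plus; unfold Rdiv; ring.
Qed.

Lemma ln_mixdens J tau mu x :
  (1 <= J)%nat -> param_space J tau mu ->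
  ln (mixdens J tau mu x) = ln (exp (- (x * x) / 2) / sqrt (2 * PI)) + ln (mgf J tau mu x).
Proof.
  intros HJ H; rewrite mixdens_mgf; apply ln_mult; [|now apply mgf_pos].
  apply Rdiv_lt_0_compat; [apply exp_pos|].
  apply sqrt_lt_R0; assert (Hpi := PI_RGT_0); lra.
Qed.

(** The log-likelihood relative to the standard normal: it differs from [- Qobj] by a term depending
    on [z] alone, so both have the same optimizers. *)
Definition loglik (n J : nat) (tau mu z : nat -> R) : R :=
  fsum n (fun i => ln (mgf J tau mu (z i))).

Lemma argmin_loglik n J z tau mu tau' mu' :
  (1 <= J)%nat -> is_argmin n J z tau mu -> param_space J tau' mu' ->
  loglik n J tau' mu' z <= loglik n J tau mu z.
Proof.
  intros HJ [H Hmin] H'; specialize (Hmin _ _ H'); unfold Qobj in Hmin.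
  rewrite (fsum_ext n (fun i => ln (mixdens J tau mu (z i)))
    (fun i => ln (exp (- (z i * z i) / 2) / sqrt (2 * PI)) + ln (mgf J tau mu (z i)))),
    (fsum_ext n (fun i => ln (mixdens J tau' mu' (z i)))
    (fun i => ln (exp (- (z i * z i) / 2) / sqrt (2 * PI)) + ln (mgf J tau' mu' (z i)))),
    !fsum_plus in Hmin by (intros; now apply ln_mixdens).
  unfold loglik; lra.
Qed.

(* Jensen, via [exp t >= exp s * (1 + (t - s))] at the weighted mean [s] of the exponents. *)
Lemma ln_mgf_tangent J tau mu x y :
  (1 <= J)%nat -> param_space J tau mu ->
  ln (mgf J tau mu x) + slope J tau mu x * (y - x) <= ln (mgf J tau mu y).
Proof.
  intros HJ H; assert (Hx := mgf_pos J tau mu x HJ H); assert (Hy := mgf_pos J tau mu y HJ H).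
  set (s := slope J tau mu x * (y - x)).
  assert (Hle : mgf J tau mu x * exp s <= mgf J tau mu y).
  { apply Rle_trans with (exp s * fsum J (fun j => coef tau mu j * exp (mu j * x)
                                                * (1 + (mu j * (y - x) - s)))).
    - right; rewrite Rmult_comm; f_equal.
      rewrite (fsum_ext J _ (fun j => (1 - s) * (coef tau mu j * exp (mu j * x))
          + (y - x) * (coef tau mu j * mu j * exp (mu j * x)))) by (intros; ring).
      rewrite fsum_plus, !fsum_scal.
      change (mgf J tau mu x = (1 - s) * mgf J tau mu x + (y - x) * mgf' J tau mu x).
      unfold s, slope; field; lra.
    - rewrite <- fsum_scal; apply fsum_le; intros j Hj.
      replace (mu j * y) with (s + (mu j * x + (mu j * (y - x) - s))) by ring.
      rewrite !exp_plus.
      assert (H1 := exp_ineq1_le (mu j * (y - x) - s)).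
      assert (H2 := coef_pos J tau mu H j Hj).
      assert (H3 := exp_pos s); assert (H4 := exp_pos (mu j * x)).
      apply Rle_trans with (exp s * (coef tau mu j * exp (mu j * x))
                            * exp (mu j * (y - x) - s)); [|right; ring].
      rewrite <- (Rmult_assoc (exp s)); apply Rmult_le_compat_l; [|exact H1].
      left; apply Rmult_lt_0_compat; [|apply Rmult_lt_0_compat]; assumption. }
  rewrite <- (ln_exp s), <- ln_mult by (assumption || apply exp_pos).
  destruct Hle as [Hlt|Heq]; [left | right; now rewrite Heq].
  apply ln_increasing; [|exact Hlt]; apply Rmult_lt_0_compat; [exact Hx | apply exp_pos].
Qed.

(** Completing the square, [mu x - mu^2/2 <= x^2/2] for each component, and the weights sum to 1.
    The bound is uniform in the parameters. *)
Lemma ln_mgf_le J tau mu x :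
  (1 <= J)%nat -> param_space J tau mu -> ln (mgf J tau mu x) <= x * x / 2.
Proof.
  intros HJ H; assert (Hx := mgf_pos J tau mu x HJ H).
  rewrite <- (ln_exp (x * x / 2)).
  assert (Hle : mgf J tau mu x <= exp (x * x / 2)).
  { destruct H as (Ht & H1 & _).
    rewrite <- (Rmult_1_r (exp _)), <- H1, <- fsum_scal.
    apply fsum_le; intros j Hj; unfold coef.
    rewrite Rmult_assoc, <- exp_plus, (Rmult_comm (exp _)).
    apply Rmult_le_compat_l; [left; now apply Ht|].
    assert (E : - (mu j * mu j) / 2 + mu j * x <= x * x / 2)
      by (assert (Hs := Rle_0_sqr (mu j - x)); unfold Rsqr in Hs; lra).
    destruct E as [E|E]; [left; now apply exp_increasing | rewrite E; lra]. }
  destruct Hle as [Hlt|Heq]; [left; now apply ln_increasing | right; now rewrite Heq].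
Qed.

(** Equal weights at means [0, ..., J-1]: the component at mean 0 alone contributes [1/J] at every
    [x]. This bounds the maximal likelihood from below. *)
Lemma exists_param J :
  (1 <= J)%nat ->
  exists tau mu, param_space J tau mu /\ forall x, - ln (INR J) <= ln (mgf J tau mu x).
Proof.
  intros HJ; assert (HJ0 : 0 < INR J) by (apply lt_0_INR; lia).
  assert (Hinv := Rinv_0_lt_compat _ HJ0).
  assert (H : param_space J (fun _ => / INR J) INR).
  { split; [intros; exact Hinv | split].
    - rewrite fsum_const; field; lra.
    - intros; rewrite S_INR; lra. }
  exists (fun _ => / INR J), INR; split; [exact H|]; intros x.
  rewrite <- ln_Rinv by exact HJ0.
  assert (Hle : / INR J <= mgf J (fun _ => / INR J) INR x).
  { apply Rle_trans with (coef (fun _ => / INR J) INR 0%nat * exp (INR 0 * x)).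
    - right; unfold coef; simpl.
      replace (- (0 * 0) / 2) with 0 by field; rewrite Rmult_0_l, exp_0; ring.
    - apply (fsum_ge_term J (fun j => coef (fun _ => / INR J) INR j * exp (INR j * x))); [lia|].
      intros k Hk; left; apply Rmult_lt_0_compat;
        [now apply (coef_pos J) | apply exp_pos]. }
  destruct Hle as [Hlt|Heq]; [left; now apply ln_increasing | right; now rewrite <- Heq].
Qed.

(* At an argmin the likelihood is bounded below, which bounds the tangents of
   the convex functions [ln mgf] from their upper bound on a larger interval. *)
Lemma argmin_slope_bound n J r :
  (1 <= J)%nat -> 0 <= r ->
  exists M, 0 <= M /\ forall z tau mu, is_argmin n J z tau mu ->
    (forall j, (j < n)%nat -> - r <= z j <= r) ->
    forall i, (i < n)%nat -> Rabs (slope J tau mu (z i)) <= M.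
Proof.
  intros HJ Hr; destruct (exists_param J HJ) as (tau0 & mu0 & H0 & Hlow).
  set (B := (r + 1) * (r + 1) / 2).
  assert (HB : 0 <= B) by (unfold B; nra).
  assert (HL : 0 <= ln (INR J)).
  { rewrite <- ln_1; apply (le_INR 1) in HJ; destruct HJ as [H|H]; simpl in H.
    - left; apply ln_increasing; lra.
    - right; now rewrite <- H. }
  exists (INR n * ln (INR J) + INR n * B + B).
  assert (Hn := pos_INR n).
  split; [nra|]; intros z tau mu Harg Hz i Hi.
  assert (Hpar : param_space J tau mu) by apply Harg.
  assert (Hup : forall x, - (r + 1) <= x <= r + 1 -> ln (mgf J tau mu x) <= B).
  { intros x Hx; apply Rle_trans with (x * x / 2); [now apply ln_mgf_le | unfold B; nra]. }
  assert (Hlo : - (INR n * ln (INR J)) <= loglik n J tau mu z).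
  { apply Rle_trans with (loglik n J tau0 mu0 z); [|now apply argmin_loglik].
    replace (- (INR n * ln (INR J))) with (INR n * - ln (INR J)) by ring.
    rewrite <- fsum_const; apply fsum_le; intros; apply Hlow. }
  (* All the deficits [B - ln mgf] are nonnegative, so a single one is at most their sum. *)
  assert (Hi' : B - ln (mgf J tau mu (z i)) <= INR n * B - loglik n J tau mu z).
  { rewrite <- fsum_const; unfold loglik; rewrite <- fsum_minus.
    apply (fsum_ge_term n (fun i => B - ln (mgf J tau mu (z i)))); [exact Hi|].
    intros k Hk; assert (Hzk := Hz k Hk).
    assert (ln (mgf J tau mu (z k)) <= B) by (apply Hup; lra); lra. }
  assert (Hzi := Hz i Hi).
  (* Unit steps to either side stay within [[-r-1, r+1]], where [B] is an upper bound; the two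
     tangents bound the slope from above and below. *)
  assert (T1 := ln_mgf_tangent J tau mu (z i) (z i + 1) HJ Hpar).
  assert (T2 := ln_mgf_tangent J tau mu (z i) (z i - 1) HJ Hpar).
  assert (U1 := Hup (z i + 1) ltac:(lra)); assert (U2 := Hup (z i - 1) ltac:(lra)).
  apply Rabs_le; lra.
Qed.

Lemma slope_eq_same_param J tau mu tau' mu' l :
  (1 <= J)%nat -> param_space J tau mu -> param_space J tau' mu' ->
  NoDup l -> (J * J <= length l)%nat ->
  Forall (fun x => slope J tau mu x = slope J tau' mu' x) l ->
  same_param J tau mu tau' mu'.
Proof.
  intros HJ H H' Hnd Hlen Hl.
  (* Coefficients [c] and exponents [e] of the Wronskian, whose zeros are the points where the
     slopes agree. *)
  set (c := fun q => (coef tau mu (q / J)%nat * mu (q / J)%nat) * coef tau' mu' (q mod J)%nat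
                     - coef tau mu (q / J)%nat * (coef tau' mu' (q mod J)%nat * mu' (q mod J)%nat)).
  set (e := fun q => mu (q / J)%nat + mu' (q mod J)%nat).
  assert (Hcross : forall x, expsum (J * J) c e x =
    mgf' J tau mu x * mgf J tau' mu' x - mgf J tau mu x * mgf' J tau' mu' x).
  { intros x; unfold mgf, mgf'; rewrite !expsum_mult; unfold expsum.
    rewrite <- fsum_minus; apply fsum_ext; intros q _; unfold c, e; ring. }
  assert (Hp := fun x => mgf_pos J tau mu x HJ H).
  assert (Hp' := fun x => mgf_pos J tau' mu' x HJ H').
  destruct (sorted_exists l Hnd) as (l' & Hs & HP).
  assert (Hzero : forall x, expsum (J * J) c e x = 0).
  { apply (expsum_zeros (J * J) c e l'); [exact Hs | now rewrite <- (Permutation_length HP) |].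
    apply (Permutation_Forall HP); eapply Forall_impl; [|exact Hl]; simpl.
    intros x Hx; rewrite Hcross; unfold slope in Hx.
    specialize (Hp x); specialize (Hp' x).
    apply (f_equal (fun t => t * mgf J tau mu x * mgf J tau' mu' x)) in Hx.
    field_simplify in Hx; lra. }
  set (k := mgf J tau mu 0 / mgf J tau' mu' 0).
  assert (Hk : 0 < k) by (now apply Rdiv_lt_0_compat).
  assert (Hprop : forall x, mgf J tau mu x = k * mgf J tau' mu' x).
  { intros x.
    assert (Hq : (mgf J tau mu / mgf J tau' mu')%F x = k).
    { apply (const_of_derivative_0 (mgf J tau mu / mgf J tau' mu')%F
        (fun y => (mgf' J tau mu y * mgf J tau' mu' y -
        mgf' J tau' mu' y * mgf J tau mu y) / Rsqr (mgf J tau' mu' y))).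
      - intros y; apply derivable_pt_lim_div; try apply derivable_pt_lim_expsum.
        specialize (Hp' y); lra.
      - intros y; specialize (Hzero y); rewrite Hcross in Hzero.
        unfold Rdiv; rewrite (Rmult_comm (mgf' J tau' mu' y)), Hzero; ring. }
    rewrite <- Hq; unfold div_fct; specialize (Hp' x); field; lra. }
  assert (Huniq : forall j, (j < J)%nat ->
            coef tau mu j = k * coef tau' mu' j /\ mu j = mu' j).
  { apply (expsum_unique J (coef tau mu) (fun j => k * coef tau' mu' j) mu mu').
    - now apply coef_pos.
    - intros j Hj; apply Rmult_lt_0_compat; [exact Hk | now apply (coef_pos J)].
    - apply H.
    - apply H'.
    - intros x; change (mgf J tau mu x =
        expsum J (fun j => k * coef tau' mu' j) mu' x).
      rewrite Hprop; unfold mgf, expsum; rewrite <- fsum_scal.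
      apply fsum_ext; intros; ring. }
  assert (Htau : forall j, (j < J)%nat -> tau j = k * tau' j).
  { intros j Hj; destruct (Huniq j Hj) as [E Emu]; unfold coef in E; rewrite Emu in E.
    apply Rmult_eq_reg_r with (exp (- (mu' j * mu' j) / 2)); [rewrite E; ring|].
    assert (Hx := exp_pos (- (mu' j * mu' j) / 2)); lra. }
  (* Both weight vectors sum to 1, which fixes the proportionality constant. *)
  assert (Hk1 : k = 1).
  { destruct H as (_ & H1 & _), H' as (_ & H1' & _).
    rewrite (fsum_ext J tau (fun j => k * tau' j)), fsum_scal, H1' in H1 by exact Htau; lra. }
  intros j Hj; split; [rewrite (Htau j Hj), Hk1; ring | now apply Huniq].
Qed.

(** * Points with two separated slopes *)

(** Tangent inequalities are summed over the coordinates: the linear term is kept for [i], and every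
    other coordinate costs at most [M * d]. *)
Lemma loglik_tangent n J tau mu z z' i d M :
  (1 <= J)%nat -> param_space J tau mu -> (i < n)%nat -> 0 <= d -> 0 <= M ->
  (forall j, (j < n)%nat -> Rabs (slope J tau mu (z j)) <= M) ->
  (forall j, (j < n)%nat -> j <> i -> Rabs (z j - z' j) <= d) ->
  loglik n J tau mu z + slope J tau mu (z i) * (z' i - z i) - INR n * (M * d)
    <= loglik n J tau mu z'.
Proof.
  intros HJ H Hi Hd HM Hs Hdist.
  set (s := slope J tau mu (z i) * (z' i - z i)).
  assert (HMd : 0 <= M * d) by nra.
  rewrite <- (fsum_single n i (fun _ => s)) by exact Hi.
  rewrite <- fsum_const; unfold loglik; rewrite <- fsum_plus, <- fsum_minus.
  apply fsum_le; intros j Hj.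
  assert (T := ln_mgf_tangent J tau mu (z j) (z' j) HJ H).
  destruct (Nat.eqb_spec j i) as [->|Hne]; [unfold s; lra|].
  assert (E : Rabs (slope J tau mu (z j) * (z' j - z j)) <= M * d).
  { rewrite Rabs_mult, (Rabs_minus_sym (z' j)).
    apply Rmult_le_compat; try apply Rabs_pos; auto. }
  assert (E' := Rle_abs (- (slope J tau mu (z j) * (z' j - z j)))).
  rewrite Rabs_Ropp in E'; lra.
Qed.

Definition slope_gap (n J i : nat) (r p q : R) (z : nat -> R) : Prop :=
  (forall j, (j < n)%nat -> - r <= z j <= r) /\
  exists tau mu tau' mu', is_argmin n J z tau mu /\ is_argmin n J z tau' mu' /\
    slope J tau mu (z i) <= p /\ q <= slope J tau' mu' (z i).

(* Two argmins at [z] support the value function [max loglik] with slopes below [p]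
   and above [q], so moving [z i] alone leaves this set. *)
Lemma null_slope_gap n J i r p q :
  (1 <= J)%nat -> (i < n)%nat -> 0 <= r -> p < q ->
  lebesgue_null n (slope_gap n J i r p q).
Proof.
  intros HJ Hi Hr Hpq.
  destruct (argmin_slope_bound n J r HJ Hr) as (M & HM & Hbound).
  assert (Hn := pos_INR n).
  assert (Hnm : 0 <= INR n * M) by (now apply Rmult_le_pos).
  assert (Hgap : forall z z' d, slope_gap n J i r p q z -> slope_gap n J i r p q z' ->
    0 <= d -> (forall j, (j < n)%nat -> j <> i -> Rabs (z j - z' j) <= d) ->
    (q - p) * (z' i - z i) <= 2 * (INR n * M) * d).
  { intros z z' d (Hz & t1 & m1 & t2 & m2 & A1 & A2 & _ & S2)
      (Hz' & t1' & m1' & t2' & m2' & A1' & A2' & S1' & _) Hd Hdist.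
    assert (0 <= INR n * M * d) by (now apply Rmult_le_pos).
    destruct (Rle_lt_dec (z' i) (z i)) as [Hle|Hlt]; [nra|].
    (* The steep argmin at [z] is followed to [z'] and the flat argmin at [z'] back to [z]. Adding
       both tangents and both optimality inequalities cancels all likelihoods and leaves the slope
       gap times [z' i - z i]. *)
    assert (T := loglik_tangent n J t2 m2 z z' i d M HJ (proj1 A2) Hi Hd HM
      (Hbound z t2 m2 A2 Hz) Hdist).
    assert (Hdist' : forall j, (j < n)%nat -> j <> i -> Rabs (z' j - z j) <= d)
      by (intros; rewrite Rabs_minus_sym; auto).
    assert (T' := loglik_tangent n J t1' m1' z' z i d M HJ (proj1 A1') Hi Hd HM
      (Hbound z' t1' m1' A1' Hz') Hdist').
    assert (O1 := argmin_loglik n J z' t1' m1' t2 m2 HJ A1' (proj1 A2)).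
    assert (O2 := argmin_loglik n J z t2 m2 t1' m1' HJ A2 (proj1 A1')).
    nra. }
  apply (null_lipschitz_graph n i _ r (2 * (INR n * M) / (q - p))); [exact Hi | exact Hr | | |].
  - apply Rmult_le_pos; [lra | left; apply Rinv_0_lt_compat; lra].
  - intros z Hz; apply Hz.
  - intros z z' d Hz Hz' Hd Hdist.
    assert (Hdist' : forall j, (j < n)%nat -> j <> i -> Rabs (z' j - z j) <= d)
      by (intros; rewrite Rabs_minus_sym; auto).
    assert (G1 := Hgap z z' d Hz Hz' Hd Hdist); assert (G2 := Hgap z' z d Hz' Hz Hd Hdist').
    assert (E : (q - p) * (2 * (INR n * M) / (q - p) * d) = 2 * (INR n * M) * d)
      by (field; lra).
    apply Rabs_le; split; apply Rmult_le_reg_l with (q - p); lra.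
Qed.

(** * Countable decomposition of the exceptional set *)

Lemma box_exists n (z : nat -> R) :
  exists r : nat, forall j, (j < n)%nat -> - INR r <= z j <= INR r.
Proof.
  destruct (INR_archimed 1 (fsum n (fun j => Rabs (z j))) Rlt_0_1) as [r Hr].
  exists r; intros j Hj.
  assert (H : Rabs (z j) <= fsum n (fun j => Rabs (z j))).
  { apply (fsum_ge_term n (fun j => Rabs (z j))); [exact Hj | intros; apply Rabs_pos]. }
  assert (H1 := Rle_abs (z j)); assert (H2 := Rle_abs (- z j)); rewrite Rabs_Ropp in H2; lra.
Qed.

(** On the diagonal [z i] equals the other coordinate [z k], hence a 1-Lipschitz graph. *)
Lemma null_diagonal n i k r :
  (i < n)%nat -> (k < n)%nat -> i <> k -> 0 <= r ->
  lebesgue_null n (fun z => (forall j, (j < n)%nat -> - r <= z j <= r) /\ z i = z k).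
Proof.
  intros Hi Hk Hne Hr; apply (null_lipschitz_graph n i _ r 1); [exact Hi | exact Hr | lra | |].
  - intros z [H _]; exact H.
  - intros z z' d [_ E] [_ E'] _ Hd; rewrite E, E', Rmult_1_l.
    apply Hd; [exact Hk | lia].
Qed.

Lemma null_empty n (S : (nat -> R) -> Prop) :
  (1 <= n)%nat -> (forall z, ~ S z) -> lebesgue_null n S.
Proof.
  intros Hn H; apply (null_lipschitz_graph n 0 S 0 0); try lia; try lra;
    intros z; intros; exfalso; now apply (H z).
Qed.

(** The separating rationals are coded by natural numbers, with [a - b] for the integer numerator,
    so that only unions over [nat] occur. *)
Lemma slope_gap_exists n J z tau mu tau' mu' i :
  is_argmin n J z tau mu -> is_argmin n J z tau' mu' ->
  slope J tau mu (z i) < slope J tau' mu' (z i) ->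
  exists r m a b : nat,
    slope_gap n J i (INR r) ((INR a - INR b) / INR (S m)) ((INR a - INR b + 1) / INR (S m)) z.
Proof.
  intros A A' Hlt.
  set (s := slope J tau mu (z i)) in *; set (s' := slope J tau' mu' (z i)) in *.
  destruct (box_exists n z) as [r Hr].
  (* Scaled by [S m], the gap exceeds 2, so [k = up (s * INR (S m))] and [k + 1] both fit between
     the scaled slopes. *)
  destruct (INR_archimed (s' - s) 2 ltac:(lra)) as [m Hm].
  set (k := up (s * INR (S m))); destruct (archimed (s * INR (S m))) as [K1 K2]; fold k in K1, K2.
  exists r, m, (Z.to_nat k), (Z.to_nat (- k)).
  assert (Ek : INR (Z.to_nat k) - INR (Z.to_nat (- k)) = IZR k)
    by (rewrite !INR_IZR_INZ, <- minus_IZR; f_equal; lia).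
  rewrite Ek; assert (Hpos : 0 < INR (S m)) by (apply lt_0_INR; lia).
  split; [exact Hr|]; exists tau, mu, tau', mu'; split; [exact A|]; split; [exact A'|].
  fold s s'; split; apply Rmult_le_reg_r with (INR (S m)); try exact Hpos;
    unfold Rdiv; rewrite Rmult_assoc, Rinv_l, Rmult_1_r by lra; [lra|].
  rewrite S_INR in *; nra.
Qed.

Lemma sqrt_le_square n J : INR J <= sqrt (INR n) -> (J * J <= n)%nat.
Proof.
  intros H; apply INR_le; rewrite mult_INR, <- (sqrt_sqrt (INR n)) by apply pos_INR.
  apply Rmult_le_compat; auto; apply pos_INR.
Qed.

Theorem theorem1 (n J : nat) (HJ : (1 <= J)%nat) (HJn : INR J <= sqrt (INR n)) :
  lebesgue_null n
    (fun z => exists tau mu tau' mu',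
        is_argmin n J z tau mu /\ is_argmin n J z tau' mu' /\
        ~ same_param J tau mu tau' mu').
Proof.
  apply sqrt_le_square in HJn; assert (Hn : (1 <= n)%nat) by nia.
  apply null_mono with (fun z =>
    (exists r i k : nat, (i < n)%nat /\ (k < n)%nat /\ i <> k /\
       (forall j, (j < n)%nat -> - INR r <= z j <= INR r) /\ z i = z k) \/
    (exists i r m a b : nat, (i < n)%nat /\ slope_gap n J i (INR r)
       ((INR a - INR b) / INR (S m)) ((INR a - INR b + 1) / INR (S m)) z)).
  - intros z (tau & mu & tau' & mu' & A & A' & Hdiff).
    destruct (classic (exists i k, (i < n)%nat /\ (k < n)%nat /\ i <> k /\ z i = z k))
      as [(i & k & Hi & Hk & Hne & E)|Hdist].
    + left; destruct (box_exists n z) as [r Hr]; now exists r, i, k.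
    + right; destruct (classic (exists i, (i < n)%nat /\
        slope J tau mu (z i) <> slope J tau' mu' (z i))) as [(i & Hi & Hs)|Hs].
      (* The argmins are ordered so that the smaller slope comes first. *)
      * exists i; destruct (Rdichotomy _ _ Hs) as [H|H].
        -- destruct (slope_gap_exists n J z _ _ _ _ i A A' H) as (r & m & a & b & G).
           now exists r, m, a, b.
        -- destruct (slope_gap_exists n J z _ _ _ _ i A' A H) as (r & m & a & b & G).
           now exists r, m, a, b.
      * exfalso; apply Hdiff.
        apply slope_eq_same_param with (map z (seq 0 n)); [exact HJ | apply A | apply A' | | |].
        -- apply NoDup_map_NoDup_ForallPairs; [|apply seq_NoDup].
           intros i k Hi Hk E; apply in_seq in Hi, Hk.
           destruct (Nat.eq_dec i k) as [H|H]; [exact H|].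
           exfalso; apply Hdist; exists i, k; repeat split; auto; lia.
        -- now rewrite length_map, length_seq.
        -- apply Forall_map, Forall_forall; intros i Hi; apply in_seq in Hi.
           apply NNPP; intros H; apply Hs; exists i; split; [lia | exact H].
  - apply null_or.
    + apply null_union; intros r; apply null_union; intros i; apply null_union; intros k.
      (* The unions run over all natural indices; inadmissible ones contribute the empty set. *)
      destruct (classic ((i < n)%nat /\ (k < n)%nat /\ i <> k)) as [(Hi & Hk & Hne)|H].
      * eapply null_mono; [|apply (null_diagonal n i k (INR r)); auto; apply pos_INR].
        intros z Hz; now apply Hz.
      * apply null_empty; [exact Hn | intros z Hz; apply H; tauto].
    + apply null_union; intros i; apply null_union; intros r; apply null_union; intros m.
      apply null_union; intros a; apply null_union; intros b.
      destruct (classic (i < n)%nat) as [Hi|Hi].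
      * eapply null_mono; [intros z Hz; exact (proj2 Hz)|].
        apply null_slope_gap; [exact HJ | exact Hi | apply pos_INR |].
        apply Rmult_lt_compat_r; [|lra].
        apply Rinv_0_lt_compat, lt_0_INR; lia.
      * apply null_empty; [exact Hn | intros z Hz; now apply Hi].
Qed.
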